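(* If a topological space $X$ has countable tightness and is scatteredly $R$-separable, then each potentially bounded $\infty$-convex subset $\mathcal F\subset SC_p(X)$ is weakly discontinuous and has network weight $nw(\mathcal F)\le nw(X)$.
   Context: A function $f:X\to\mathbb R$ is scatteredly continuous if for each non-empty subset $A\subset X$ the restriction $f|A$ has a point of continuity. $SC_p(X)$ is the linear space of all scatteredly continuous real-valued functions on $X$, with the topology of pointwise convergence (inherited from $\mathbb R^X$). $X$ has countable tightness if for each $A\subset X$ and each $a\in\bar A$ there is an at most countable $B\subset A$ with $a\in\bar B$. $X$ is scatteredly $R$-separable if for each countable subspace $Z\subset X$ without isolated points and each sequence $(D_n)_{n\in\omega}$ of dense subsets of $Z$ there are points $z_n\in D_n$, $n\in\omega$, such that the subspace $\{z_n\}_{n\in\omega}$ is not scattered (a space is scattered if each of its non-empty subspaces has an isolated point). A subset $B$ of a (real) linear topological space $L$ is bounded if for each neighborhood $U\subset L$ of zero there is $n\in\mathbb N$ with $B\subset nU$. $B$ is potentially bounded if for each sequence $(x_n)_{n\in\omega}$ of points of $B$ there is a sequence $(t_n)_{n\in\omega}$ of positive reals such that $\{t_nx_n\}_{n\in\omega}$ is bounded in $L$. A subset $K$ of $L$ is $\infty$-convex if for each sequence $(x_n)_{n\in\omega}$ in $K$ that is bounded in $L$ and each sequence $(t_n)_{n\in\omega}$ of non-negative reals with $\sum_{n=0}^\infty t_n=1$ the series $\sum_{n=0}^\infty t_nx_n$ converges to a point of $K$. These notions are applied with $L=SC_p(X)$. A family $\mathcal F$ of real-valued functions on $X$ is weakly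 discontinuous if each non-empty subset $A\subset X$ contains a subset $U\subset A$, open and dense in $A$, such that $f|U$ is continuous for every $f\in\mathcal F$. The network weight $nw(Y)$ of a space $Y$ is the smallest cardinality of a network of the topology of $Y$ (a network is a family $\mathcal N$ of subsets of $Y$ such that for every open $W\subset Y$ and $y\in W$ there is $N\in\mathcal N$ with $y\in N\subset W$). $\mathcal F$ carries the topology of pointwise convergence.
   Formalization: Network weight is taken to be infinite (ℵ₀ plus the least cardinality of a network), since for X a point and F=[0,1] the bare inequality nw(F) ≤ nw(X) fails; in scattered R-separability Z is non-empty, as otherwise no space would qualify. *)

(* Defs.v *)
From HB Require Import structures.
From mathcomp Require Import all_boot all_order all_algebra.
From mathcomp Require Import all_classical all_reals all_analysis.

Set Implicit Arguments.
Unset Strict Implicit.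
Unset Printing Implicit Defensive.

Import Order.TTheory GRing.Theory Num.Theory.
Import numFieldNormedType.Exports.

Local Open Scope classical_set_scope.
Local Open Scope ring_scope.
Local Open Scope card_scope.

Section GeneralTopology.
Context {X : topologicalType}.

Definition countable_tightness :=
  forall (A : set X) (a : X), closure A a ->
  exists B : set X, [/\ B `<=` A, countable B & closure B a].

Definition scattered (A : set X) :=
  forall B : set X, B `<=` A -> B !=set0 -> isolated B !=set0.

(* [Z] has to be non-empty: in the empty subspace the only dense subset is
   empty, and no points could be selected from it. *)
Definition scatteredly_R_separable :=
  forall Z : set X, Z !=set0 -> countable Z -> isolated Z = set0 ->
  forall D : nat -> set X, (forall n, D n `<=` Z /\ Z `<=` closure (D n)) ->
  exists z : nat -> X, (forall n, D n (z n)) /\ ~ scattered (range z).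

Context {Y : topologicalType}.

Definition scatteredly_continuous (f : X -> Y) :=
  forall A : set X, A !=set0 ->
  exists2 a, A a & f @ within A (nbhs a) --> f a.

Definition weakly_discontinuous (F : set (X -> Y)) :=
  forall A : set X, A !=set0 ->
  exists U : set X,
    [/\ exists2 V, open V & U = A `&` V,
        A `<=` closure U &
        forall f, F f -> {within U, continuous f}].

End GeneralTopology.
Arguments countable_tightness X : clear implicits.
Arguments scatteredly_R_separable X : clear implicits.

Section TopologicalVectorSpaces.
Context {R : realType} {L : topologicalLmodType R}.

(* [bounded_set] is only defined over normed spaces *)
Definition tvs_bounded (B : set L) :=
  forall U : set L, nbhs 0 U ->
  exists2 n : nat, (0 < n)%N & B `<=` [set n%:R *: u | u in U].

Definition potentially_bounded (B : set L) :=
  forall x : nat -> L, (forall n, B (x n)) ->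
  exists2 t : nat -> R, (forall n, 0 < t n) &
    tvs_bounded (range (fun n => t n *: x n)).

Definition infty_convex (K : set L) :=
  forall (x : nat -> L) (t : nat -> R),
  (forall n, K (x n)) -> tvs_bounded (range x) ->
  (forall n, 0 <= t n) -> series t @ \oo --> (1 : R) ->
  exists2 k : L, K k & series (fun n => t n *: x n) @ \oo --> k.

End TopologicalVectorSpaces.

Section NetworkWeight.

Definition network (Y : topologicalType) (N : set (set Y)) :=
  forall (W : set Y) (y : Y), open W -> W y ->
  exists B : set Y, [/\ N B, B y & B `<=` W].

Definition least_network (Y : topologicalType) (N : set (set Y)) :=
  network N /\ forall M : set (set Y), network M -> N #<= M.

Lemma ex_least_card (T : Type) (P : set (set T)) :
  P !=set0 -> exists2 A, P A & forall B, P B -> A #<= B.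
Proof.
move=> [A0 PA0].
pose G (S : set (set T -> T)) :=
  (forall s A, S s -> P A -> A (s A)) /\
  (forall s s' A, S s -> S s' -> P A -> s A = s' A -> s = s').
have [|S [[SP Sinj] Smax]] := @Zorn_bigcup _ G.
  move=> H HG totH; split=> [s A [S HS Ss] PA|].
    exact: ((HG _ HS).1 s A).
  move=> s s' A [S HS Ss] [S' HS' Ss'] PA.
  have [SS'|S'S] := totH _ _ HS HS'.
    by apply: ((HG _ HS').2 s s' A) => //; exact: SS'.
  by apply: ((HG _ HS).2 s s' A) => //; exact: S'S.
have [[A PA AS]|noA] :=
    pselect (exists2 A, P A & A `<=` (fun s => s A) @` S).
  exists A => // B PB; apply: (card_le_trans (subset_card_le AS)).
  apply: (card_le_trans (card_image_le _ _)).
  have /card_eqPle[+ _] : S #= (fun s : set T -> T => s B) @` S.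
    rewrite card_eq_sym; apply: inj_card_eq => s s' /set_mem Ss /set_mem Ss'.
    exact: (Sinj s s' B).
  move=> /card_le_trans; apply; apply: subset_card_le => _ [s Ss <-].
  exact: (SP s B).
have new A : P A -> exists2 a, A a & forall s, S s -> s A <> a.
  move=> PA; apply: contrapT => h; apply: noA; exists A => // a Aa.
  apply: contrapT => nS; apply: h; exists a => // s Ss sa.
  by apply: nS; exists s.
have [t0 _ _] := new _ PA0.
have /choice[c cP] : forall A, exists a, P A ->
    A a /\ forall s, S s -> s A <> a.
  move=> A; have [PA|nPA] := pselect (P A); last by exists t0.
  by have [a Aa Sa] := new _ PA; exists a.
exfalso; apply: (Smax (S `|` [set c])).
  split=> [|/(_ c (or_intror erefl)) Sc]; first exact: subsetUl.
  exact: ((cP _ PA0).2 _ Sc).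
split=> [s A [Ss|->] PA|s s' A [Ss|->] [Ss'|->] PA //].
- exact: (SP s A).
- exact: (cP A PA).1.
- exact: (Sinj s s' A).
- by move/((cP _ PA).2 _ Ss).
- by move/esym/((cP _ PA).2 _ Ss').
Qed.

Lemma least_network_ex (Y : topologicalType) :
  exists N : set (set Y), least_network N.
Proof.
have [|N nN minN] := @ex_least_card (set Y) (@network Y); last by exists N.
by exists setT => W y _ Wy; exists W; split.
Qed.

(* A set whose cardinality is the network weight of [Y]: the disjoint union of
   [nat] and of a network of least cardinality.  The summand [nat] implements
   the usual convention that cardinal functions only take infinite values;
   without it, [nw F <= nw X] fails for [F = [0, 1]] over a one-point [X]. *)
Definition nw (Y : topologicalType) : set (nat + set Y) :=
  range inl `|` inr @` get (@least_network Y).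

End NetworkWeight.
Arguments nw Y : clear implicits.

Section ScatteredlyContinuousFunctions.
Context {X : topologicalType} {R : realType}.
Implicit Types (f g : X -> R) (A : set X).

Lemma scatteredly_continuous_open f A : scatteredly_continuous f ->
  A !=set0 -> exists V, [/\ open V, (A `&` V) !=set0 &
    forall a, (A `&` V) a -> f @ within A (nbhs a) --> f a].
Proof.
move=> fSC A0; apply: contrapT => noV.
pose D := [set a | f @ within A (nbhs a) --> f a].
have bad V : open V -> (A `&` V) !=set0 -> exists2 a, (A `&` V) a & ~ D a.
  move=> oV AV0; apply: contrapT => h; apply: noV; exists V; split=> // a AVa.
  by apply: contrapT => nDa; apply: h; exists a.
have [|e [Ae nDe] fe] := fSC (A `\` D).
  have [|a [Aa _] nDa] := bad _ openT; first by rewrite setIT.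
  by exists a.
apply: nDe; apply/cvgrPdist_lt => /= eps eps0.
have eps20 : 0 < eps / 2 by rewrite divr_gt0.
move/cvgrPdist_lt : fe => /(_ _ eps20).
rewrite !near_withinE nbhsE => -[V [oV Ve] VP]; exists V; first by split.
move=> x Vx Ax; have [Dx|nDx] := pselect (D x); last first.
  apply: lt_trans (_ : eps / 2 < eps); first exact: VP.
  by rewrite ltr_pdivrMr// ltr_pMr// ltr1n.
move/cvgrPdist_lt : Dx => /(_ _ eps20).
rewrite near_withinE nbhsE => -[W [oW Wx] WP].
have [||y [Ay [Vy Wy]] nDy] := bad (V `&` W); [exact: openI|by exists x|].
rewrite -(subrKA (f y)) (splitr eps); apply: (le_lt_trans (ler_normD _ _)).
by apply: ltrD; [exact: VP|rewrite distrC; exact: WP].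
Qed.

Definition scfun : {pred (X -> R)} :=
  mem [set f : X -> R | scatteredly_continuous f].

Lemma scfun_submod_closed : submod_closed scfun.
Proof.
split.
  rewrite inE => A [a Aa]; exists a => //; exact: cvg_cst.
move=> k f g; rewrite !inE => fSC gSC A A0.
have [V [oV AV0 fV]] := scatteredly_continuous_open fSC A0.
have [a AVa ga] := gSC _ AV0; have [Aa Va] := AVa; exists a => //.
have {}ga : g @ within A (nbhs a) --> g a.
  move=> P /ga nP.
  have nV : nbhs a V by exact: open_nbhs_nbhs.
  rewrite /nbhs/= /within/= in nP *.
  by apply: filterS2 nP nV => x Px Vx Ax; exact: Px.
apply: (@cvgD _ R^o); last exact: ga.
by apply: cvgZr; exact: fV.
Qed.

HB.instance Definition _ :=
  GRing.isSubmodClosed.Build R (X -> R) scfun scfun_submod_closed.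

End ScatteredlyContinuousFunctions.
Arguments scfun X R : clear implicits.

Section SCp.
Context (X : topologicalType) (R : realType).

(* Scatteredly continuous functions form a linear subspace of [X -> R], so
   that [SCp] is an [lmodType]; its topology is induced by the inclusion
   into [{ptws X -> R}]. *)
Record SCp := SCpSub { sc_val :> X -> R ; sc_valP : sc_val \in scfun X R }.

HB.instance Definition _ := [isSub for sc_val].
HB.instance Definition _ := [Choice of SCp by <:].
HB.instance Definition _ := [SubChoice_isSubLmodule of SCp by <:].
HB.instance Definition _ := Topological.copy SCp
  (initial_topology (sc_val : SCp -> {ptws X -> R})).

Lemma SCp_cvgP (F : set_system SCp) (f : SCp) : Filter F ->
  F --> f <-> forall x, (fun g : SCp => g x) @ F --> f x.
Proof.
move=> FF; split=> [Ff x|Ff U [_ /= [[W oW <-]] Wf /filterS]].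
  have : {ptws, sc_val @ F --> sc_val f}.
    exact: (cvg_comp _ _ Ff
      (@initial_continuous _ _ (sc_val : SCp -> {ptws X -> R}) f)).
  by move=> /(pointwise_cvgP (sc_val f) (fmap_filter _ FF))/(_ x); exact.
apply; have : {ptws, sc_val @ F --> sc_val f}.
  exact/(pointwise_cvgP (sc_val f) (fmap_filter _ FF)).
by apply; exact: open_nbhs_nbhs.
Qed.

Lemma SCp_eval_continuous (x : X) : continuous (fun g : SCp => g x).
Proof. by move=> h; exact: ((SCp_cvgP h (nbhs_filter h)).1 (@cvg_id _ _) x). Qed.

Lemma SCp_add_continuous : continuous (fun z : SCp * SCp => z.1 + z.2).
Proof.
move=> z; apply/SCp_cvgP => x.
have c1 : (fun y : SCp * SCp => y.1 x) @ z --> z.1 x.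
  exact: (@continuous_comp _ _ _ (@fst _ SCp) (fun g : SCp => g x) z
    cvg_fst (@SCp_eval_continuous x z.1)).
have c2 : (fun y : SCp * SCp => y.2 x) @ z --> z.2 x.
  exact: (@continuous_comp _ _ _ (@snd _ SCp) (fun g : SCp => g x) z
    cvg_snd (@SCp_eval_continuous x z.2)).
exact: (cvgD c1 c2).
Qed.

Lemma SCp_scale_continuous : continuous (fun z : R^o * SCp => z.1 *: z.2).
Proof.
move=> z; apply/SCp_cvgP => x.
have c1 : (fun y : R^o * SCp => y.1 : R) @ z --> (z.1 : R) by exact: cvg_fst.
have c2 : (fun y : R^o * SCp => y.2 x) @ z --> z.2 x.
  exact: (@continuous_comp _ _ _ (@snd _ SCp) (fun g : SCp => g x) z
    cvg_snd (@SCp_eval_continuous x z.2)).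
exact: (cvgM c1 c2).
Qed.

HB.instance Definition _ :=
  PreTopologicalNmodule_isTopologicalNmodule.Build SCp SCp_add_continuous.
HB.instance Definition _ :=
  TopologicalNmodule_isTopologicalLmodule.Build R SCp SCp_scale_continuous.

End SCp.

(* Main.v *)
Require Import Defs.
From mathcomp Require Import all_boot all_order all_algebra.
From mathcomp Require Import all_classical all_reals all_analysis.
From mathcomp Require Import ring lra zify.

(* If [F] is not weakly discontinuous, countable tightness yields a countable T0
   subspace [Q = {q_n}] without isolated points, [f0] in [F] continuous on [Q],
   and [f_n] in [F] discontinuous on [Q] at [q_n].  By potential boundedness the
   functions [g_n = t_n (f_n - f0)] are pointwise bounded for some [t_n > 0], and
   by infinite convexity [F] contains [f0 + sum_n s_n g_n] whenever [s_n >= 0] and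
   [sum_n s_n <= 1].
   If the [g_n] are uniformly bounded on some non-empty relatively open subset of
   [Q], rapidly decreasing [s_n] make the sum discontinuous everywhere on it.
   Otherwise the sets [D_n] of the points of [Q] at which some [|g_m|] exceeds
   [8 n 4^n] are dense in [Q]; scattered R-separability selects [z_n] in [D_n]
   forming a non-scattered set, and for some choice of the coefficients the
   resulting [f] in [F] satisfies [|f z_n| >= n].  Where such an [f] is locally
   bounded on a subset of [{z_n}], that subset is locally finite, hence has an
   isolated point.  Both cases are contradictory.
   For the network weight, call an open set good when [nw X] sets suffice to
   follow all the functions of [F] on it.  Arbitrary unions of good sets are good,
   because [X] has a network of cardinality [nw X], and weak discontinuity enlarges
   every good set that is not the whole of [X]. *)

Import Order.TTheory GRing.Theory Num.Theory.
Import numFieldNormedType.Exports.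

Local Open Scope classical_set_scope.
Local Open Scope ring_scope.
Local Open Scope card_scope.

(** * Infinite cardinals *)

(** The default value [u] makes injections total functions, which spares later arguments the
    subtypes. *)
Lemma card_le_injP {T U : Type} {A : set T} {B : set U} (u : U) :
  A #<= B <-> exists2 f : T -> U, (forall x, A x -> B (f x)) &
                {in A &, injective f}.
Proof.
split=> [/card_leP[g]|[f fAB finj]].
  pose f x := if pselect (A x) is left Ax then \val (g (SigSub (mem_set Ax)))
              else u.
  exists f => [x Ax|x y /set_mem Ax /set_mem Ay].
    rewrite /f; case: pselect => // Ax'.
    by case: (g _) => y /= /set_mem.
  rewrite /f; case: pselect => // Ax'; case: pselect => // Ay'.
  move=> /val_inj /(inj (mem_setT _) (mem_setT _)).
  by move=> /(congr1 val).
have /card_eqPle[_ h] := inj_card_eq finj.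
apply: card_le_trans h _; apply: subset_card_le => _ [x Ax <-]; exact: fAB.
Qed.

Section SmallSets.
Context {V : Type} {K : set V}.
Hypothesis Kinf : [set: nat] #<= K.
Hypothesis KK : K `*` K #<= K.

Lemma small_base : exists k, K k.
Proof.
apply: contrapT => nK; have K0 : K = set0.
  by rewrite -subset0 => k Kk; apply: nK; exists k.
move: Kinf; rewrite K0 card_le0 => /eqP/seteqP[+ _].
by move=> /(_ 0%N I).
Qed.

(** A point of the union is coded by a chosen index and its code in that member, hence by a pair in
    the square of [K]. [KK] is assumed rather than derived because the proof that every infinite set
    satisfies it uses these lemmas. *)
Lemma small_bigcup {I T : Type} (D : set I) (F : I -> set T) :
  D #<= K -> (forall i, D i -> F i #<= K) -> \bigcup_(i in D) F i #<= K.
Proof.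
have [k Kk] := small_base.
move=> /(card_le_injP k)[d dK dinj] FK.
have /choice[f fP] : forall i, exists f : T -> V, D i ->
    (forall x, F i x -> K (f x)) /\ {in F i &, injective f}.
  move=> i; have [Di|nDi] := pselect (D i); last by exists (fun=> k).
  by have /(card_le_injP k)[f] := FK _ Di; exists f.
have [[i0 Di0]|D0] := pselect (D !=set0); last first.
  rewrite bigcup0 => [|i Di]; first exact: card_ge0.
  by exfalso; apply: D0; exists i.
have /choice[c cP] : forall x, exists i, (\bigcup_(i in D) F i) x -> D i /\ F i x.
  move=> x; have [[i Di Fx]|nx] := pselect ((\bigcup_(i in D) F i) x).
    by exists i.
  by exists i0.
apply: card_le_trans KK; apply/(card_le_injP (k, k)).
exists (fun x => (d (c x), f (c x) x)).
  by move=> x /cP[Dc Fc]; split => /=; [exact: dK|apply: (fP _ Dc).1].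
move=> x y /set_mem/cP[Dcx Fcx] /set_mem/cP[Dcy Fcy] [].
move=> /dinj; rewrite !inE => /(_ Dcx Dcy) cxy.
by rewrite -cxy in Fcy *; apply: (fP _ Dcx).2; exact: mem_set.
Qed.

Lemma small_countable {T : Type} (A : set T) : countable A -> A #<= K.
Proof. by move/card_le_trans; apply. Qed.

Lemma small_setU {T : Type} (A B : set T) : A #<= K -> B #<= K -> A `|` B #<= K.
Proof.
move=> AK BK; rewrite -bigcup2inE; apply: small_bigcup.
  by apply: small_countable; exact: countableP.
by case=> [|[|i]] // _ /=; rewrite /bigcup2/=.
Qed.

Lemma small_setX {T U : Type} (A : set T) (B : set U) :
  A #<= K -> B #<= K -> A `*` B #<= K.
Proof.
move=> AK BK; have -> : A `*` B = \bigcup_(a in A) ((fun b => (a, b)) @` B).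
  apply/seteqP; split=> [[a b] [/= Aa Bb]|_ [a Aa [b Bb <-]]] //.
  by exists a => //; exists b.
apply: small_bigcup => // a _; exact: card_le_trans (card_image_le _ _) BK.
Qed.

End SmallSets.

(** [B] is the domain of a maximal injective relation from a square to its side. A set [C] outside
    [B] of the same cardinality would allow an extension: the new pairs in the square of the union
    inject into [C]. *)
Lemma infinite_card_setX_ex {T : Type} {S : set T} (t : T) :
  [set: nat] #<= S ->
  exists B : set T, [/\ B `<=` S, [set: nat] #<= B, B `*` B #<= B &
    forall C, C `<=` S `\` B -> B #<= C -> ~ (C #<= B)].
Proof.
move=> /(card_le_injP t)[e eS einj].
pose C0 := range e.
have [C0inf C0le] : [set: nat] #<= C0 /\ C0 #<= [set: nat].
  by have /card_eqPle[] := inj_card_eq einj.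
have C0C0 : C0 `*` C0 #<= C0.
  apply: card_le_trans C0inf; apply: countableX; exact: C0le.
have [g0 g0C g0inj] := (card_le_injP t).1 C0C0.
pose G0 : set (T * T * T) := [set p | (C0 `*` C0) p.1 /\ p.2 = g0 p.1].
pose dom (G : set (T * T * T)) := [set a | exists b c, G (a, b, c)].
(* Zorn's lemma is applied to the injective, possibly multivalued, relations [G]
   from [B * B] to [B], where [B := dom G]; [G0] keeps [B] infinite. *)
pose P (G : set (T * T * T)) := [/\ G = set0 \/ G0 `<=` G,
  forall a b c, G (a, b, c) -> [/\ S a, dom G a, dom G b & dom G c],
  forall a b, dom G a -> dom G b -> exists c, G (a, b, c) &
  forall p q c, G (p, c) -> G (q, c) -> p = q].
have [H HP totH|G [[G0G GS Gtot Ginj] Gmax]] := @Zorn_bigcup _ P.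
  have domH a : dom (\bigcup_(G in H) G) a -> exists2 G, H G & dom G a.
    by move=> [b [c [G HG Gabc]]]; exists G => //; exists b, c.
  have domS G : H G -> dom G `<=` dom (\bigcup_(G in H) G).
    by move=> HG a [b [c Gabc]]; exists b, c, G.
  split.
  - have [[G HG GG0]|h] := pselect (exists2 G, H G & G0 `<=` G).
      by right=> p /GG0 Gp; exists G.
    left; rewrite bigcup0// => G HG.
    by have [[->|G0G] _ _ _] := HP _ HG => //; exfalso; apply: h; exists G.
  - move=> a b c [G HG Gabc]; have [_ /(_ _ _ _ Gabc)[? ? ? ?] _ _] := HP _ HG.
    by split=> //; exact: (domS G).
  - move=> a b /domH[G1 HG1 G1a] /domH[G2 HG2 G2b].
    have [G12|G21] := totH _ _ HG1 HG2.
      have [_ _ G2tot _] := HP _ HG2.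
      have [||c G2c] := G2tot a b => //; last by exists c, G2.
      by move: G1a => [b' [c' /G12 ?]]; exists b', c'.
    have [_ _ G1tot _] := HP _ HG1.
    have [||c G1c] := G1tot a b => //; last by exists c, G1.
    by move: G2b => [b' [c' /G21 ?]]; exists b', c'.
  - move=> p q c [G1 HG1 G1p] [G2 HG2 G2q].
    have [G12|G21] := totH _ _ HG1 HG2.
      by have [_ _ _ G2inj] := HP _ HG2; apply: G2inj G2q; exact: G12.
    by have [_ _ _ G1inj] := HP _ HG1; apply: G1inj (G21 _ G2q).
have dG0 : dom G0 = C0.
  apply/seteqP; split=> [a [b [c [[] /=]]]//|a C0a].
  by exists a, (g0 (a, a)); split.
have PG0 : P G0.
  split=> [|a b c [[/= C0a C0b] ->]|a b|p q c].
  - by right.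
  - rewrite dG0; split => //; first by case: C0a => n _ <-; exact: eS.
    exact: g0C.
  - by rewrite dG0 => C0a C0b; exists (g0 (a, b)).
  - by move=> [/= Cp ->] [/= Cq] /g0inj; rewrite !inE; exact.
have {}G0G : G0 `<=` G.
  case: G0G => // G00; exfalso; apply: (Gmax G0) => //; rewrite G00.
  split; first exact: sub0set.
  move=> /(_ (e 0%N, e 0%N, g0 (e 0%N, e 0%N))); apply; split => //.
  by split; exists 0%N.
pose B := dom G.
have BS : B `<=` S by move=> a [b [c /GS[]]].
have Binf : [set: nat] #<= B.
  apply: card_le_trans C0inf _; apply: subset_card_le; rewrite -dG0.
  by move=> a [b [c /G0G ?]]; exists b, c.
have BB : B `*` B #<= B.
  have /choice[g gP] : forall p : T * T, exists c, (B `*` B) p -> G (p, c).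
    move=> [a b]; have [[Ba Bb]|nB] := pselect ((B `*` B) (a, b)).
      by have [c Gc] := Gtot _ _ Ba Bb; exists c.
    by exists t.
  apply/(card_le_injP t); exists g; first by move=> [a b] /gP/GS[].
  move=> p q /set_mem/gP Gp /set_mem/gP Gq gpq.
  by apply: Ginj Gp _; rewrite gpq.
exists B; split=> // C CSB BC CB.
have [c0 Cc0] : exists c, C c.
  have [f fBC _] := (card_le_injP t).1 (card_le_trans Binf BC).
  by exists (f 0%N); exact: fBC.
pose B' := B `|` C.
have B'B : B' #<= B by exact: small_setU.
have : (B' `*` B') `\` (B `*` B) #<= C.
  apply: card_le_trans BC; 
  apply: (@card_le_trans _ _ _ (B' `*` B')); last exact: small_setX.
  by apply: subset_card_le => p [].
move=> /(card_le_injP t)[j jC jinj].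
have {}jinj p q : ((B' `*` B') `\` (B `*` B)) p ->
    ((B' `*` B') `\` (B `*` B)) q -> j p = j q -> p = q.
  by move=> Ep Eq /jinj; rewrite !inE; exact.
pose E := [set p | ((B' `*` B') `\` (B `*` B)) p.1 /\ p.2 = j p.1].
have nBC c : C c -> ~ B c by move=> /CSB[].
have GB a b c : G (a, b, c) -> [/\ B a, B b & B c] by case/GS.
have domE a : dom (G `|` E) a -> B' a.
  move=> [b [c [/GB[]|]]]; first by left.
  by move=> [[[]]].
have Edom a : B' a -> dom (G `|` E) a.
  move=> B'a; exists c0, (j (a, c0)); right; split=> //=; split.
    by split => //; right.
  by move=> [_ /(nBC _ Cc0)].
apply: (Gmax (G `|` E)).
  split; first exact: subsetUl.
  move=> /(_ (c0, c0, j (c0, c0))) h.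
  have /GB[/(nBC _ Cc0)] // : G (c0, c0, j (c0, c0)).
  apply: h; right; split=> //=; split; last by move=> [/(nBC _ Cc0)].
  by split; right.
split.
- by right=> p /G0G; left.
- move=> a b c Gabc; split.
  + have : B' a by apply: domE; exists b, c.
    by move=> [/BS|/CSB[]].
  + by exists b, c.
  + apply: Edom; case: Gabc => [/GB[_]|[/= [[]]]] //; by left.
  + apply: Edom; case: Gabc => [/GB[_ _]|[/= E' ->]]; first by left.
    by right; exact: jC.
- move=> a b /domE B'a /domE B'b.
  have [[Ba Bb]|nB] := pselect ((B `*` B) (a, b)).
    by have [c Gc] := Gtot _ _ Ba Bb; exists c; left.
  by exists (j (a, b)); right.
- move=> [p p'] q c [Gp|[/= Ep ->]] [Gq|[/= Eq]].
  + exact: Ginj Gp Gq.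
  + move=> cE; have /nBC[] := jC _ Eq.
    by rewrite -cE; have [] := GB _ _ _ Gp.
  + case: q Gq => q q' /GB[_ _ Bj]; by have /nBC := jC (p, p') Ep.
  + exact: jinj.
Qed.

(** [ex_least_card] compares [B] with its complement in [S]. The choice of [B] excludes an embedding
    of [B] in the complement, so the complement, and with it [S], embeds in [B]. *)
Lemma infinite_card_setX {T : Type} {S : set T} :
  [set: nat] #<= S -> S `*` S #<= S.
Proof.
move=> Sinf; have [t _] := small_base Sinf.
have [B [BS Binf BB Bmax]] := infinite_card_setX_ex t Sinf.
have SB : S `\` B #<= B.
  have [|A] := @ex_least_card _ [set B; S `\` B]; first by exists B; left.
  move=> [->|-> minA]; last by apply: minA; left.
  move=> /(_ _ (or_intror erefl)) /(card_le_injP t)[i iSB iinj].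
  exfalso; have /card_eqPle[iB Bi] := inj_card_eq iinj.
  by apply: (Bmax (i @` B)) => // _ [b Bb <-]; exact: iSB.
have SleB : S #<= B.
  have -> : S = B `|` (S `\` B) by rewrite setDUK.
  exact: small_setU.
apply: (@card_le_trans _ _ _ B); first exact: small_setX.
exact: subset_card_le.
Qed.

(** * Network weight *)

(** [M] is fixed before [f] and serves all functions of [F] at once. Only the points are restricted
    to [A]; the sets may leave it. *)
Definition family_network {X Y : topologicalType} (F : set (X -> Y)) (A : set X)
    (M : set (set X)) :=
  forall f x O, F f -> A x -> open O -> O (f x) ->
  exists B, [/\ M B, B x & B `<=` f @^-1` O].

Lemma weakly_discontinuous_network {V : Type} {K : set V} {X Y : topologicalType}
    (F : set (X -> Y)) (N : set (set X)) :
  [set: nat] #<= K -> weakly_discontinuous F -> network N -> N #<= K ->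
  exists2 M, M #<= K & family_network F setT M.
Proof.
move=> Kinf Fwd netN NK; have KK := infinite_card_setX Kinf.
pose good W := exists2 M, M #<= K & family_network F W M.
pose W := \bigcup_(G in [set G | open G /\ good G]) G.
have oW : open W by apply: bigcup_open => G [].
(* The members of [N] lying in a good open set cover [W]; there are at most [K] of them, and their
   families are united. *)
have [M0 M0K netM0] : good W.
  pose D := [set B | N B /\ exists2 G, open G /\ good G & B `<=` G].
  have /choice[M MP] : forall B, exists M : set (set X), D B ->
      M #<= K /\ family_network F B M.
    move=> B; have [[NB [G [oG [M MK netM]] BG]]|nDB] := pselect (D B).
      exists M => _; split => // f x O Ff Bx; apply: netM => //; exact: BG.
    by exists set0.
  exists (\bigcup_(B in D) M B).
    apply: small_bigcup => //; last by move=> B /MP[].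
    by apply: card_le_trans NK; apply: subset_card_le => B [].
  move=> f x O Ff [G [oG goodG] Gx] oO Ofx.
  have [B [NB Bx BG]] := netN G x oG Gx.
  have DB : D B by split=> //; exists G.
  have [_ /(_ f x O Ff Bx oO Ofx)[C [MC Cx CO]]] := MP _ DB.
  by exists C; split => //; exists B.
(* Otherwise weak discontinuity, applied to the complement of [W], yields a [G] whose union with [W]
   is good although [G] leaves [W]. *)
have WT x : W x.
  apply: contrapT => nWx.
  have [|U [[G oG UE] WU Fcont]] := Fwd (~` W); first by exists x.
  have [u [Uu _]] := WU x nWx _ filterT.
  have [nWu Gu] : (~` W `&` G) u by rewrite -UE.
  apply: nWu; exists (W `|` G); last by right.
  split; first exact: openU.
  (* Traces on [U] are taken because outside [W] continuity is known only within [U]. *)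
  exists (M0 `|` [set B `&` U | B in N]).
    apply: small_setU => //; exact: card_le_trans (card_image_le _ _) NK.
  move=> f y O Ff WGy oO Ofy; have [Wy|nWy] := pselect (W y).
    by have [B [M0B By BO]] := netM0 f y O Ff Wy oO Ofy; exists B; split => //; left.
  have Uy : U y by rewrite UE; split=> //; case: WGy.
  move/subspace_continuousP : (Fcont f Ff) => /(_ y Uy O).
  rewrite nbhs_simpl /within /= => /(_ (open_nbhs_nbhs (conj oO Ofy))).
  rewrite nbhsE => -[H [oH Hy] HO].
  have [B [NB By BH]] := netN H y oH Hy.
  exists (B `&` U); split=> [|//|z [/BH/HO Oz /Oz]//].
  by right; exists B.
by exists M0 => // f x O Ff _; exact: netM0.
Qed.

(** Finite intersections, graded by the number of factors to allow induction. *)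
Fixpoint meets {T : Type} (E : set (set T)) (n : nat) : set (set T) :=
  if n is n'.+1 then [set B `&` C | B in meets E n' & C in E] else [set setT].

Lemma small_meets {V : Type} {K : set V} {T : Type} (E : set (set T)) :
  [set: nat] #<= K -> E #<= K -> \bigcup_(n in setT) meets E n #<= K.
Proof.
move=> Kinf EK; have KK := infinite_card_setX Kinf.
apply: small_bigcup => // n _; elim: n => [|n IH] /=.
  by apply: small_countable => //; exact: countable1.
have -> : [set B `&` C | B in meets E n & C in E] =
    (fun p => p.1 `&` p.2) @` (meets E n `*` E).
  apply/seteqP; split=> [_ [B EB [C EC <-]]|_ [[B C] [/= EB EC] <-]].
    by exists (B, C).
  by exists B => //; exists C.
by apply: card_le_trans (card_image_le _ _) _; exact: small_setX.
Qed.

Lemma nbhs_meets {T : Type} (E : set (set T)) (t : T) :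
  Filter (filter_from [set B | (\bigcup_n meets E n) B /\ B t] id).
Proof.
apply: filter_from_filter; first by exists setT; split=> //; exists 0%N.
move=> B C [[m _ mB] Bt] [[n _ nC] Ct].
exists (B `&` C) => //; split=> //; exists (m + n)%N => //.
elim: n C nC {Ct} => [_ ->|n IH _ [C nC [D ED <-]]] /=; first by rewrite addn0 setIT.
by rewrite addnS /= setIA; exists (B `&` C); [exact: IH|exists D].
Qed.

Lemma SCp_network {V : Type} {K : set V} {R : realType} {X : topologicalType}
    (F : set (SCp X R)) (M : set (set X)) :
  [set: nat] #<= K -> M #<= K ->
  family_network [set sc_val f | f in F] setT M ->
  exists2 N : set (set (set_type F)), N #<= K & network N.
Proof.
move=> Kinf MK netM; have KK := infinite_card_setX Kinf.
pose e (p : set X * (rat * rat)) : set (set_type F) :=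
  [set f | forall x, p.1 x -> ratr p.2.1 < (set_val f : SCp X R) x < ratr p.2.2].
pose E := e @` (M `*` [set: rat * rat]).
have EK : E #<= K.
  apply: card_le_trans (card_image_le _ _) _; apply: small_setX => //.
  by apply: small_countable => //; exact: countableP.
exists (\bigcup_(n in setT) meets E n); first exact: small_meets.
move=> W f oW Wf.
(* The network property at [f] follows from the convergence to [f] of the filter generated by the
   members containing [f]; in the pointwise topology this is tested at single points, where one set
   [e (B, (p, q))] suffices. *)
pose Phi := filter_from [set B | (\bigcup_n meets E n) B /\ B f] id.
have PhiF : Filter Phi := nbhs_meets E f.
suff : Phi W by move=> [B [EB Bf] BW]; exists B.
have : (set_val : set_type F -> SCp X R) @ Phi --> (set_val f : SCp X R).
  apply/SCp_cvgP => x; apply/cvgrPdist_lt => eps eps0.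
  set fx := (set_val f : SCp X R) x.
  have [|p] := @rat_in_itvoo R (fx - eps) fx; first by rewrite ltrBlDr ltrDl.
  have [|q] := @rat_in_itvoo R fx (fx + eps); first by rewrite ltrDl.
  rewrite !in_itv/= => /andP[fq qe] /andP[ep pf].
  have [|||B [MB Bx BO]] := netM (sc_val (set_val f : SCp X R)) x [set` `]ratr p, ratr q[] _ I.
  - by exists (set_val f) => //; exact: set_valP.
  - exact: interval_open.
  - by rewrite /= in_itv/= pf fq.
  exists (e (B, (p, q))).
    split; last by move=> y /BO; rewrite /= in_itv.
    exists 1%N => //; exists setT => //; exists (e (B, (p, q))); last by rewrite setTI.
    by exists (B, (p, q)).
  move=> g /(_ _ Bx)/= /andP[pg gq]; rewrite distrC real_ltr_distl ?num_real//.
  by rewrite (lt_trans ep pg) (lt_trans gq qe).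
case: oW => O oO OW valf; rewrite -OW; apply: valf.
by apply: open_nbhs_nbhs; split => //; move: Wf; rewrite -OW.
Qed.

Lemma card_nw_le {V : Type} {K : set V} {Y : topologicalType} (N : set (set Y)) :
  [set: nat] #<= K -> network N -> N #<= K -> nw Y #<= K.
Proof.
move=> Kinf netN NK; have KK := infinite_card_setX Kinf.
apply: small_setU => //; first exact: card_le_trans (card_image_le _ _) Kinf.
apply: card_le_trans (card_image_le _ _) _; apply: card_le_trans NK.
have [L leastL] := least_network_ex Y.
have [_] := getI leastL; exact.
Qed.

Lemma nw_infinite (X : topologicalType) : [set: nat] #<= nw X.
Proof.
have /card_eqPle[_ h] : range (@inl nat (set X)) #= [set: nat].
  by apply: inj_card_eq => x y _ _ [].
by apply: card_le_trans h _; apply: subset_card_le; left.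
Qed.

Lemma network_le_nw (X : topologicalType) :
  exists2 N : set (set X), network N & N #<= nw X.
Proof.
have [L leastL] := least_network_ex X; have [netN _] := getI leastL.
exists (get (@least_network X)) => //.
have /card_eqPle[_ h] : @inr nat _ @` get (@least_network X) #= get (@least_network X).
  by apply: inj_card_eq => B C _ _ [].
apply: card_le_trans h _; apply: subset_card_le => z; by right.
Qed.

Lemma weakly_discontinuous_nw {R : realType} {X : topologicalType}
    (F : set (SCp X R)) :
  weakly_discontinuous [set sc_val f | f in F] -> nw (set_type F) #<= nw X.
Proof.
move=> Fwd; have Xinf := nw_infinite X.
have [N netN NX] := network_le_nw X.
have [M MX netM] := weakly_discontinuous_network _ N Xinf Fwd netN NX.
have [L LX netL] := SCp_network F M Xinf MX netM.
exact: card_nw_le LX.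
Qed.

(** * Infinitely convex sets of scatteredly continuous functions *)

Section SCpConvexity.
Context {R : realType} {X : topologicalType}.
Implicit Types (B F : set (SCp X R)) (f : SCp X R).

Lemma SCp_boundedP B :
  tvs_bounded B <-> forall x, exists C : R, forall f, B f -> `|f x| <= C.
Proof.
split=> [Bbnd x|Bbnd U U0].
  have : nbhs (0 : SCp X R) [set f | `|f x| < 1].
    have /cvgr0Pnorm_lt := @SCp_eval_continuous X R x 0.
    exact.
  move=> /Bbnd[n n0 BU]; exists n%:R => f /BU[u /= ux <-].
  rewrite normrM ger0_norm//; apply: le_trans (ler_pM _ _ (lexx _) (ltW ux)) _ => //.
  by rewrite mulr1.
(* By the pointwise bounds, the multiples of members of [B] by [n.+1%:R^-1] tend to zero, so all
   those with large [n] lie in [U]. *)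
pose S k : set (SCp X R) :=
  [set g | exists n f, [/\ (k <= n)%N, B f & g = n.+1%:R^-1 *: f]].
have FS : Filter (filter_from setT S).
  apply: filter_from_filter; first by exists 0%N.
  move=> i j _ _; exists (maxn i j) => // g [n [f [ijn Bf ->]]].
  split; exists n, f; split=> //; apply: leq_trans ijn.
    exact: leq_maxl.
  exact: leq_maxr.
have : filter_from setT S --> (0 : SCp X R).
  apply/SCp_cvgP => x; have [C BC] := Bbnd x.
  apply/cvgr0Pnorm_lt => eps eps0.
  have [k Ck] : exists k : nat, C / eps < k%:R.
    exists (Num.bound `|C / eps|); apply: le_lt_trans (ler_norm _) _.
    exact: archi_boundP.
  exists k => // g [n [f [kn Bf ->]]] /=.
  rewrite normrM ger0_norm ?invr_ge0// mulrC ltr_pdivrMr//.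
  apply: le_lt_trans (BC _ Bf) _; rewrite mulrC -ltr_pdivrMr//.
  by apply: lt_le_trans Ck _; rewrite ler_nat leqW.
move=> /(_ _ U0)[k _ SU]; exists k.+1 => // f Bf.
exists (k.+1%:R^-1 *: f); first by apply: SU; exists k, f.
by rewrite scalerA divff ?scale1r// pnatr_eq0.
Qed.

Lemma infty_convex_sum F (k : nat -> SCp X R) (t : nat -> R) :
  infty_convex F -> (forall n, F (k n)) ->
  (forall x, exists C : R, forall n, `|k n x| <= C) ->
  (forall n, 0 <= t n) -> series t @ \oo --> (1 : R) ->
  exists2 f, F f & forall x, series (fun n => t n * k n x) @ \oo --> f x.
Proof.
move=> Fconv Fk kbnd t0 t1.
have [||f Ff cvf] := Fconv k t _ _ t0 t1 => //.
  apply/SCp_boundedP => x; have [C kC] := kbnd x.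
  by exists C => _ [n _ <-].
exists f => // x.
have /SCp_cvgP/(_ x) := cvf.
have seriesE n : (series (fun m => t m *: k m) n : SCp X R) x =
    series (fun m => t m * k m x) n.
  rewrite /series /=; elim/big_ind2 : _ => //= u v u' v' <- <-.
  by [].
by rewrite (_ : (fun g : SCp X R => g x) @ (_ @ \oo) =
    (fun n => series (fun m => t m * k m x) n) @ \oo) //;
  congr (_ @ \oo); apply/funext => n /=.
Qed.

(* Infinite convexity is applied to [f0, k 0, k 1, ...], where [f0] takes up the
   weight left by [s]. *)
Lemma infty_convex_subsum F f0 (k : nat -> SCp X R) (s : nat -> R) :
  infty_convex F -> F f0 -> (forall n, F (k n)) ->
  (forall x, exists C : R, forall n, `|k n x| <= C) ->
  (forall n, 0 <= s n) -> (forall n, series s n <= 1) ->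
  exists2 f, F f &
    forall x, series (fun n => s n * (k n x - f0 x)) @ \oo --> f x - f0 x.
Proof.
move=> Fconv Ff0 Fk kbnd s0 s1.
have nds : nondecreasing_seq (series s).
  by apply/nondecreasing_seqP => n; rewrite seriesSr lerDl.
have cvs : cvgn (series s).
  by apply: nondecreasing_is_cvgn => //; exists 1 => _ [n _ <-].
pose sg := limn (series s).
have sg1 : sg <= 1 by apply: limr_le => //; exact: nearW.
pose k' n := if n is n'.+1 then k n' else f0.
pose t n := if n is n'.+1 then s n' else 1 - sg.
have seriesS (u : nat -> R) n : series u n.+1 = u 0%N + series (fun m => u m.+1) n.
  by rewrite /series/= big_nat_recl.
have cvw : 1 - sg + series s n @[n --> \oo] --> (1 : R).
  by rewrite -{2}[1](subrK sg); apply: cvgD => //; exact: cvg_cst.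
have [|x|[|n]||f Ff cvf] := infty_convex_sum F k' t Fconv.
- by case.
- have [C kC] := kbnd x; exists (Num.max C `|f0 x|) => -[|n] /=.
    by rewrite le_max lexx orbT.
  by rewrite le_max kC.
- by rewrite subr_ge0.
- exact: s0.
- rewrite -cvg_shiftS; under eq_fun do rewrite seriesS.
  exact: cvw.
exists f => // x.
have cv1 : series (fun n => t n * k' n x) n.+1 @[n --> \oo] --> f x.
  by rewrite (cvg_shiftS (series _)).
have cv2 : (1 - sg + series s n) * f0 x @[n --> \oo] --> f0 x.
  by rewrite -[f0 x in X in _ --> X]mul1r; apply: cvgMl.
have E n : series (fun n => t n * k' n x) n.+1 - (1 - sg + series s n) * f0 x =
    series (fun n => s n * (k n x - f0 x)) n.
  rewrite seriesS /= (mulrDl (1 - sg)) opprD addrACA subrr add0r mulr_suml -sumrB.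
  by apply: eq_bigr => i _; rewrite mulrBr.
by rewrite -(funext E); exact: cvgB.
Qed.

(** Ordinary convexity: a subsum with a single coefficient that may be non-zero. *)
Lemma infty_convex_segment F f g (t : R) :
  infty_convex F -> F f -> F g -> 0 <= t <= 1 ->
  exists2 h, F h & forall x, h x = f x + t * (g x - f x).
Proof.
move=> Fconv Ff Fg /andP[t0 t1].
have serE (u : nat -> R) n : (forall m, u m.+1 = 0) -> series u n.+1 = u 0%N.
  by move=> u0; rewrite /series/= big_nat_recl// big1_seq ?addr0.
have [x|[|n]|[|n]|h Fh cvh] :=
    infty_convex_subsum F f (fun=> g) (fun n => if n is 0%N then t else 0)
      Fconv Ff (fun=> Fg).
- by exists `|g x|.
- exact: t0.
- by [].
- by rewrite /series/= big_geq.
- by rewrite serE.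
exists h => // x; have cv := cvh x.
have : (fun=> t * (g x - f x)) @ \oo --> h x - f x.
  move: cv; rewrite -cvg_shiftS; rewrite (_ : [sequence _]_n = fun=> t * (g x - f x)) //.
  by apply/funext => n /=; rewrite serE // => m; exact: mul0r.
move=> /(cvg_unique (@norm_hausdorff _ _)) /(_ (cvg_cst _)) <-.
by rewrite addrC subrK.
Qed.

Lemma potentially_bounded_perturbation F f0 (f : nat -> SCp X R) :
  potentially_bounded F -> infty_convex F -> F f0 -> (forall n, F (f n)) ->
  exists t : nat -> R, exists k : nat -> SCp X R,
    [/\ forall n, 0 < t n, forall n, F (k n),
        forall n x, k n x = f0 x + t n * (f n x - f0 x) &
        forall x, exists C : R, forall n, `|k n x - f0 x| <= C].
Proof.
move=> Fpot Fconv Ff0 Ff.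
have [t t0 /SCp_boundedP tf] := Fpot f Ff.
(* The cap at 1 keeps [k n] on the segment from [f0] to [f n]; smaller coefficients preserve the
   bounds. *)
pose t' n := Num.min (t n) 1.
have t'0 n : 0 < t' n by rewrite lt_min t0 ltr01.
have t'1 n : t' n <= 1 by rewrite ge_min lexx orbT.
have /choice[k kP] : forall n, exists h, F h /\
    forall x, h x = f0 x + t' n * (f n x - f0 x).
  move=> n; have [|h Fh hE] := infty_convex_segment F f0 (f n) (t' n) Fconv Ff0 (Ff n).
    by rewrite ltW//=.
  by exists h.
exists t', k; split=> [//|n|n x|x]; [exact: (kP n).1|exact: (kP n).2|].
have [C tfC] := tf x; exists (C + `|f0 x|) => n.
rewrite (kP n).2 addrAC subrr add0r mulrBr; apply: le_trans (ler_normB _ _) _.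
apply: lerD; last by rewrite normrM ger0_norm ?ler_piMl// ltW.
have := tfC _ (ex_intro2 _ _ n I erefl); apply: le_trans.
rewrite (_ : (t n *: f n : SCp X R) x = t n * f n x)// !normrM.
by rewrite ler_wpM2r// !gtr0_norm// /t' ge_min lexx.
Qed.

End SCpConvexity.

(** * Avoiding countably many slabs *)

(* Each coordinate is uniformly distributed, so the union bound applies to the
   events [bad n], each of which has small probability on lines in direction [n]. *)
Lemma grid_avoidance (N K : nat) (bad : 'I_N -> {ffun 'I_N -> 'I_K.+1} -> bool)
    (b : 'I_N -> nat) :
  (forall n (c : {ffun 'I_N -> 'I_K.+1}),
    #|[set j | bad n [ffun i => if i == n then j else c i]]%SET| <= b n)%N ->
  (\sum_n b n <= K)%N ->
  exists c, forall n, ~~ bad n c.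
Proof.
move=> badb bK.
(* Addition in ['I_K.+1] is cyclic, so the translations by [d i] permute the grid; summing over them
   counts the bad points line by line. *)
have count n : (K.+1 * \sum_c bad n c <= b n * #|{ffun 'I_N -> 'I_K.+1}|)%N.
  pose d i : {ffun 'I_N -> 'I_K.+1} := [ffun m => if m == n then i else 0].
  have -> : (K.+1 * \sum_c bad n c = \sum_(i < K.+1)
      \sum_(c : {ffun 'I_N -> 'I_K.+1}) bad n (c + d i)%R)%N.
    rewrite -[X in (X * _)%N]card_ord -sum_nat_const; apply: eq_bigr => i _.
    by rewrite (reindex_inj (addIr (d i))).
  rewrite exchange_big /= mulnC -sum_nat_const; apply: leq_sum => c _.
  apply: leq_trans (badb n c); rewrite -sum1dep_card.
  rewrite [leqRHS](reindex_inj (addrI (c n))) /= [leqRHS]big_mkcond /=.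
  apply: leq_sum => i _.
  have -> : c + d i = [ffun m => if m == n then c n + i else c m].
    by apply/ffunP => m; rewrite !ffunE; case: eqP => [->|]; rewrite ?addr0.
  by case: (bad n _).
(* If every grid point were bad for some [n], summing [count] over [n] would give
   [K.+1 <= \sum_n b n <= K]. *)
apply: contrapT => hbad.
have : (#|{ffun 'I_N -> 'I_K.+1}| <=
    \sum_(c : {ffun 'I_N -> 'I_K.+1}) \sum_n bad n c)%N.
  rewrite -sum1_card; apply: leq_sum => c _.
  have [n badn] : exists n, bad n c.
    apply: contrapT => nbad; apply: hbad; exists c => n; apply/negP => badn.
    by apply: nbad; exists n.
  by rewrite (bigD1 n)//= badn.
rewrite exchange_big /= -(leq_pmul2l (ltn0Sn K)) big_distrr /=.
move=> /leq_trans/(_ (leq_sum _ (fun n _ => count n))).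
rewrite -big_distrl /= leq_pmul2r; last first.
  by apply/card_gt0P; exists [ffun=> ord0].
by move=> /leq_trans/(_ bK); rewrite ltnn.
Qed.

(** Subtracting the minimum embeds [A] in ['I_b]. *)
Lemma card_le_diam (K b : nat) (A : {set 'I_K}) :
  (forall i j, i \in A -> j \in A -> (i < j + b)%N) -> (#|A| <= b)%N.
Proof.
move=> Ab; have [->|[i0 Ai0]] := set_0Vmem A; first by rewrite cards0.
pose m := [arg min_(i < i0 in A) (i : nat)].
have [Am minm] : m \in A /\ forall i, i \in A -> (m <= i)%N.
  by rewrite /m; case: arg_minnP.
case: b => [|b] in Ab *; first by have := Ab m m Am Am; rewrite addn0 ltnn.
pose f (i : 'I_K) : 'I_b.+1 := inord (i - m).
rewrite -[leqRHS](card_ord b.+1) -(card_in_imset (f := f)) ?max_card//.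
move=> i j Ai Aj /(congr1 val)/=; have := Ab _ _ Ai Am; have := Ab _ _ Aj Am.
have := minm i Ai; have := minm j Aj => mj mi jb ib.
rewrite !inordK; [move=> ij; apply/val_inj => /=|..]; lia.
Qed.

Section Avoidance.
Context {R : realType}.

Notation w n := (2^-1 ^+ n.+1 : R).

(** The [u j] are sought among the multiples of [1 / K] in the unit interval, with [K = 2 ^ N]. *)
Lemma finite_avoidance (N : nat) (a : nat -> R) (g : nat -> nat -> R) :
  (forall n, 8 * n%:R * 4 ^+ n <= `|g n n|) ->
  exists u : nat -> R, (forall j, 0 <= u j <= 1) /\
    forall n, (n < N)%N -> n%:R <= `|a n + \sum_(j < N) w j * u j * g j n|.
Proof.
move=> gC; pose K := (2 ^ N)%N; have K0 : 0 < K%:R :> R by rewrite ltr0n expn_gt0.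
pose h (c : {ffun 'I_N -> 'I_K.+1}) n :=
  a n + \sum_(j < N) w j * ((c j : nat)%:R / K%:R) * g j n.
pose bad (n : 'I_N) c := `|h c n| < n%:R.
(* On a line in direction [n], [h _ n] moves in steps of modulus at least
   [w n * (8 n 4^n) / 2^N = 2 n / b n], so at most [b n] grid points are bad; and
   [\sum_n b n = 2^N - 1]. *)
pose b (n : 'I_N) := (2 ^ (N - n.+1))%N.
have [n c||c cP] := grid_avoidance N K bad b.
- apply: card_le_diam => i j; rewrite !inE /bad => badi badj.
  pose c' k : {ffun 'I_N -> 'I_K.+1} := [ffun m => if m == n then k else c m].
  have hB : h (c' i) n - h (c' j) n =
      w n * ((i : nat)%:R - (j : nat)%:R) / K%:R * g n n.
    rewrite /h opprD addrACA subrr add0r -sumrB (bigD1 n)//= big1 ?addr0.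
      rewrite !ffunE eqxx; ring.
    by move=> m /negPf mn; rewrite !ffunE mn subrr.
  have : `|h (c' i) n - h (c' j) n| < n%:R *+ 2.
    by rewrite mulr2n; apply: le_lt_trans (ler_normB _ _) _; exact: ltrD.
  rewrite ltnNge; apply: contraTN => ijb; rewrite -leNgt hB.
  have bE : (b n)%:R / K%:R = w n :> R.
    rewrite /b /K !natrX -[in X in _ / X](subnKC (ltn_ord n)) exprD exprVn.
    by rewrite invfM mulrCA divff ?mulr1// expf_neq0.
  have w0 : 0 < w n by rewrite exprn_gt0// invr_gt0.
  have ijw : w n <= ((i : nat)%:R - (j : nat)%:R) / K%:R.
    by rewrite -bE ler_pM2r ?invr_gt0// lerBrDl -natrD ler_nat.
  rewrite -mulrA -mulrA !normrM (gtr0_norm w0) [X in _ * X]mulrA -normrM.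
  rewrite (ger0_norm (le_trans (ltW w0) ijw)).
  apply: (@le_trans _ _ (w n * (w n * (8 * n%:R * 4 ^+ n)))); last first.
    rewrite ler_pM2l//; apply: ler_pM; [exact: ltW| |exact: ijw|exact: gC].
    by rewrite !mulr_ge0// exprn_ge0.
  (* One factor [w n] is the weight of the coordinate, the other the fraction [b n / K]. [4 ^+ n]
     absorbs both, and the constant 8 leaves [2 n], too much for two values of modulus below [n]. *)
  have ww : w n * w n * 4 ^+ n = 4^-1.
    rewrite -exprMn (_ : 2^-1 * 2^-1 = 4^-1); last by rewrite -invfM; congr _^-1; ring.
    by rewrite exprS -mulrA -exprMn mulVf ?expr1n ?mulr1.
  rewrite mulrA [8 * _ * _]mulrC mulrA ww -mulr_natr; lra.
- rewrite (reindex_inj rev_ord_inj) /= (eq_bigr (fun i : 'I_N => 2 ^ i)%N) => [|i _].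
    by have := predn_exp 2 N; rewrite mul1n => <-; exact: leq_pred.
  by congr (2 ^ _)%N; have := ltn_ord i; rewrite /=; lia.
pose u j := if insub j is Some i then (c i : nat)%:R / K%:R else 0 : R.
exists u; split=> [j|n nN].
  rewrite /u; case: insubP => [i _ _|_]; last by rewrite lexx ler01.
  by rewrite divr_ge0//= ler_pdivrMr// mul1r ler_nat -ltnS.
have := cP (Ordinal nN); rewrite /bad -leNgt /=.
rewrite /h; congr (_ <= `| _ + _ |); apply: eq_bigr => i _.
by rewrite /u valK.
Qed.

Lemma dyadic_series_tail (v : nat -> R) (C : R) (J N : nat) :
  (forall j, `|v j| <= C) -> (J <= N)%N ->
  `|series (fun j => w j * v j) N - series (fun j => w j * v j) J| <= C * 2^-1 ^+ J.
Proof.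
move=> vC JN; have C0 : 0 <= C := le_trans (normr_ge0 _) (vC 0%N).
(* With this sharper bound the induction telescopes. *)
suff : `|series (fun j => w j * v j) N - series (fun j => w j * v j) J|
    <= C * (2^-1 ^+ J - 2^-1 ^+ N).
  by move/le_trans; apply; rewrite ler_wpM2l// gerBl exprn_ge0.
elim: N JN => [|N IH]; first by rewrite leqn0 => /eqP ->; rewrite !subrr normr0 mulr0.
rewrite leq_eqVlt => /predU1P[->|/IH {}IH]; first by rewrite !subrr normr0 mulr0.
rewrite seriesSr addrAC; apply: le_trans (ler_normD _ _) _.
apply: le_trans (lerD IH (_ : _ <= w N * C)) _.
  by rewrite normrM ger0_norm ?ler_wpM2l// exprn_ge0.
rewrite exprS; lra.
Qed.

Lemma avoidance (a : nat -> R) (g : nat -> nat -> R) :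
  (forall n, 8 * n%:R * 4 ^+ n <= `|g n n|) ->
  (forall n, exists C : R, forall j, `|g j n| <= C) ->
  exists u : nat -> R, (forall j, 0 <= u j <= 1) /\
    forall n (l : R), series (fun j => w j * (u j * g j n)) @ \oo --> l ->
      n%:R <= `|a n + l|.
Proof.
move=> gC gbnd.
have /choice[U UP] N := finite_avoidance N a g gC.
(* Compactness: the solutions for finite [N] converge along an ultrafilter. *)
have [G [GU ooG]] := @ultraFilterLemma nat \oo _.
have /choice[u uP] : forall j, exists r : R,
    `[0, 1]%classic r /\ U N j @[N --> G] --> r.
  move=> j; have [|r [r01 Ur]] := @segment_compact R 0 1 (U N j @[N --> G]) _.
    by apply: (@filterE _ G) => N; rewrite /= in_itv /=; exact: (UP N).1.
  (* A cluster point of an ultrafilter is a limit of it. *)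
  exists r; split=> // B rB; have [//|nB] := in_ultra_setVsetC [set N | B (U N j)] GU.
  by have [x []] := Ur (~` B) B nB rB.
have u01 j : 0 <= u j <= 1 by have [] := uP j; rewrite /= in_itv.
exists u; split=> // n l cvl; have [C gnC] := gbnd n.
have vC (v : nat -> R) : (forall j, 0 <= v j <= 1) -> forall j, `|v j * g j n| <= C.
  move=> v01 j; have /andP[v0 v1] := v01 j; rewrite normrM ger0_norm//.
  by apply: le_trans (gnC j); rewrite ler_piMl.
(* Cutting the sum of [N] terms at [J] costs at most [C / 2 ^ J], whatever [N] is; hence the limit
   in [N] can be taken before the limit in [J]. *)
have partial J : n%:R - C * 2^-1 ^+ J <=
    `|a n + series (fun j => w j * (u j * g j n)) J|.
  have : `|a n + series (fun j => w j * (U N j * g j n)) J| @[N --> G] -->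
      `|a n + series (fun j => w j * (u j * g j n)) J|.
    apply: cvg_norm; apply: cvgD; first exact: cvg_cst.
    apply: cvg_big => [|i _]; first exact: add_continuous.
    by apply: cvgMr; apply: cvgMl; exact: (uP i).2.
  move=> /cvgr_to_ge; apply; apply: ooG; exists (maxn J n.+1) => // N /=.
  rewrite geq_max => /andP[JN nN]; have := (UP N).2 n nN.
  have := dyadic_series_tail _ C J N (vC _ (UP N).1) JN.
  rewrite (_ : \sum_(j < N) _ = series (fun j => w j * (U N j * g j n)) N); last first.
    by rewrite /series/= big_mkord; apply: eq_bigr => i _; rewrite mulrA.
  set sN := series _ N; set sJ := series _ J => NJ aN.
  rewrite lerBlDr; apply: le_trans aN _; rewrite -(addrNK sJ sN) addrC -addrA.
  rewrite [X in `|X|]addrC [sJ + _]addrC.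
  by apply: le_trans (ler_normD _ _) _; rewrite lerD2l.
have cvC : n%:R - C * 2^-1 ^+ J @[J --> \oo] --> (n%:R : R).
  have cvw : 2^-1 ^+ J @[J --> \oo] --> (0 : R).
    by apply: cvg_expr; rewrite ger0_norm ?invr_ge0// invf_lt1// ltr1n.
  rewrite -[X in _ --> X]subr0 -[X in _ - X](mulr0 C).
  by apply: cvgB; [exact: cvg_cst|exact: cvgMr].
have cvS : `|a n + series (fun j => w j * (u j * g j n)) J| @[J --> \oo] --> `|a n + l|.
  by apply: cvg_norm; apply: cvgD => //; exact: cvg_cst.
by apply: (ler_cvg_to cvC cvS); exact: nearW.
Qed.

End Avoidance.

(** * Discontinuity points *)

Section Jumps.
Context {X : topologicalType} {R : realType}.
Implicit Types (A B D Q : set X) (f g h : X -> R) (F : set (X -> R)).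

(** Discontinuity with its size [e], put as membership in a closure so that countable tightness
    applies. *)
Definition jump A f a :=
  exists2 e : R, 0 < e & closure (A `&` [set x | e <= `|f x - f a|]) a.

Lemma not_jump A f a : ~ jump A f a <-> f @ within A (nbhs a) --> f a.
Proof.
split=> [nj|/cvgrPdist_lt fa [e e0 cl]].
  apply/cvgrPdist_lt => e e0; rewrite near_withinE.
  apply: contrapT => nU; apply: nj; exists e => // U aU.
  apply: contrapT => AU0; apply: nU.
  apply: filterS aU => x Ux Ax; rewrite ltNge; apply/negP => ex.
  by apply: AU0; exists x; split=> //; split=> //=; rewrite distrC.
have := fa _ e0; rewrite near_withinE => /cl[x [[Ax /= ex]]] /(_ Ax).
by rewrite distrC ltNge ex.
Qed.

Lemma jump_nbhs A f a U : nbhs a U -> jump A f a -> jump (A `&` U) f a.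
Proof.
move=> aU [e e0 cl]; exists e => // V aV.
have [x [[Ax ex] [Ux Vx]]] := cl _ (filterI aU aV).
by exists x.
Qed.

Lemma jump_addZ A f g a (c : R) :
  0 < c -> ~ jump A f a -> jump A g a -> jump A (fun x => f x + c * g x) a.
Proof.
move=> c0 /not_jump fa; apply: contraPP => /not_jump fga.
apply/not_jump.
have gE : g = fun x => c^-1 * ((f x + c * g x) - f x).
  by apply/funext => x; rewrite addrAC subrr add0r mulKf// gt_eqF.
rewrite [X in X @ _]gE {2}gE; apply: cvgMr; exact: cvgB.
Qed.

(** Jumps are taken within [A] itself, so a subset need not inherit them: each reduction below must
    retain points witnessing them. *)
Definition bad F A := A !=set0 /\ forall a, A a -> exists2 f, F f & jump A f a.

(** The union [V] of all open sets free of jumps on [A] is itself free of them. If its trace on [A]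
    is not dense, an open [G] missing that trace cuts out of [A] a set with densely many jumps. *)
Lemma not_weakly_discontinuous F : ~ weakly_discontinuous F ->
  exists2 A, A !=set0 & forall V, open V -> (A `&` V) !=set0 ->
    exists2 a, (A `&` V) a & exists2 f, F f & jump A f a.
Proof.
move=> nwd; apply: contrapT => nA; apply: nwd => A A0.
pose good V := open V /\ forall a f, (A `&` V) a -> F f -> ~ jump A f a.
pose V := \bigcup_(V in good) V.
have Vgood : good V.
  split=> [|a f [Aa [W [oW Wgood] Wa]] Ff]; last exact: Wgood.
  by apply: bigcup_open => W [].
exists (A `&` V); split.
- by exists V => //; exact: (proj1 Vgood).
- move=> a Aa U; rewrite nbhsE => -[G [oG Oa] OU].
  apply: contrapT => AVU; apply: nA; exists (A `&` G); first by exists a.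
  move=> W oW [x [[Ax Ox] Wx]]; apply: contrapT => njump.
  apply: AVU; exists x; split; last exact: OU.
  split=> //; exists (G `&` W) => //; split; first exact: openI.
  move=> y f [Ay [Oy Wy]] Ff fy; apply: njump; exists y => //; exists f => //.
  by apply: jump_nbhs => //; exact: open_nbhs_nbhs.
- move=> f Ff; apply/subspace_continuousP => a AVa; apply/not_jump => j.
  apply: (proj2 Vgood a f AVa Ff).
  have [e e0 cl] := j; exists e => // U /cl[x [[[Ax _] ex] Ux]].
  by exists x.
Qed.

(** Near a jump [a] of size [e] there are [x] in [A] with [f x] at distance at least [e] from [f a].
    Either [f] jumps at [x], so that [x] is in [D], or [f] is continuous at [x] and a point of [D]
    near [x] keeps the distance [e / 2]. *)
Lemma dense_jumps_bad F A : A !=set0 ->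
  (forall V, open V -> (A `&` V) !=set0 ->
    exists2 a, (A `&` V) a & exists2 f, F f & jump A f a) ->
  exists2 D, D `<=` A & bad F D.
Proof.
move=> [a0 Aa0] Ad; pose D := [set a | A a /\ exists2 f, F f & jump A f a].
exists D => [a []//|]; split.
  by have [|a [Aa _] aj] := Ad _ openT; [exists a0|exists a].
move=> a [Aa [f Ff [e e0 cl]]]; exists f => //; exists (e / 2); first exact: divr_gt0.
move=> U; rewrite nbhsE => -[G [oG Oa] OU].
have [x [[Ax /= ex] Ox]] := cl G (open_nbhs_nbhs (conj oG Oa)).
have [jx|] := pselect (jump A f x).
  exists x; split; last exact: OU.
  by split=> [|/=]; [split=> //; exists f|lra].
move=> /not_jump/cvgrPdist_lt/(_ (e / 2)); rewrite near_withinE.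
move=> /(_ (divr_gt0 e0 (ltr0Sn _ _))); rewrite nbhsE => -[W [oW Wx] WP].
have [||y [Ay [Oy Wy]] jy] := Ad (G `&` W); [exact: openI|by exists x|].
exists y; split; last exact: OU.
split=> //=; have := WP y Wy Ay; have := ler_distD (f y) (f x) (f a); lra.
Qed.

Definition T0_subspace A :=
  forall x y, A x -> A y -> (forall V, open V -> (V x <-> V y)) -> x = y.

(** The restriction to [[set x; y]] has a point of continuity, all of whose neighbourhoods contain
    both points. *)
Lemma scatteredly_continuous_indiscernible f x y : scatteredly_continuous f ->
  (forall V, open V -> (V x <-> V y)) -> f x = f y.
Proof.
move=> fSC xy.
have key a b : (a = x /\ b = y) \/ (a = y /\ b = x) ->
    f @ within [set x; y] (nbhs a) --> f a -> f b = f a.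
  move=> ab fa; apply/eqP; rewrite -subr_eq0 -normr_eq0; apply/eqP/le_anti.
  rewrite normr_ge0 andbT; apply/ler_addgt0Pr => e e0; rewrite add0r.
  move/cvgrPdist_lt : fa => /(_ e e0); rewrite near_withinE nbhsE => -[W [oW Wa] WP].
  rewrite distrC ltW//; apply: WP; last by case: ab => -[_ ->]; [right|left].
  by case: ab Wa => -[-> ->] /(xy _ oW).
have [|a [->|->]] := fSC [set x; y]; first by exists x; left.
  by move=> /(key x y)->//; left.
by move=> /(key y x)->//; right.
Qed.

(** One representative [r x] is kept of each class of indistinguishable points; functions of [F] are
    constant on classes, so jumps survive. T0 is what later gives finite subsets isolated points. *)
Lemma bad_T0_subspace F D : (forall f, F f -> scatteredly_continuous f) ->
  bad F D -> exists2 E, E `<=` D & bad F E /\ T0_subspace E.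
Proof.
move=> FSC [[a0 Da0] Dbad].
pose eqv (x y : X) := forall V, open V -> (V x <-> V y).
pose r x := xget a0 [set y | D y /\ eqv x y].
have rP x : D x -> D (r x) /\ eqv x (r x).
  by move=> Dx; apply: (@xgetPex _ a0 [set y | D y /\ eqv x y]); exists x.
have rE x y : eqv x y -> r x = r y.
  move=> xy; rewrite /r; congr xget; apply/seteqP; split=> z [Dz xz]; split=> // V oV.
    by rewrite -(xy V oV); exact: xz.
  by rewrite (xy V oV); exact: xz.
exists (r @` D) => [_ [x Dx <-]|]; first exact: (rP x Dx).1.
split; last first.
  move=> _ _ [x Dx <-] [y Dy <-] rxy; apply: rE => V oV.
  by rewrite (rP x Dx).2// rxy// -(rP y Dy).2.
split; first by exists (r a0), a0.
move=> _ [x Dx <-]; have [f Ff [e e0 cl]] := Dbad (r x) (rP x Dx).1.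
exists f => //; exists e => // U; rewrite nbhsE => -[G [oG Ox] OU].
have [y [[Dy /= ey] Oy]] := cl G (open_nbhs_nbhs (conj oG Ox)).
exists (r y); split; last by apply: OU; apply/((rP y Dy).2 G oG).
split; first by exists y.
by rewrite /= -(scatteredly_continuous_indiscernible _ _ _ (FSC f Ff) (rP y Dy).2).
Qed.

(** Starting from one point, countable sets witnessing the jumps at the points already taken are
    added over and over; [Q] is the union of all stages. *)
Lemma bad_countable F D : countable_tightness X -> bad F D ->
  exists2 Q, Q `<=` D & countable Q /\ bad F Q.
Proof.
move=> tight [[a0 Da0] Dbad].
have /choice[B BP] : forall a, exists B, D a -> [/\ B `<=` D, countable B &
    exists2 f, F f & exists2 e : R, 0 < e &
      closure (B `&` [set x | e <= `|f x - f a|]) a].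
  move=> a; have [Da|nDa] := pselect (D a); last by exists set0.
  have [f Ff [e e0 cl]] := Dbad a Da; have [B [BS cB Ba]] := tight _ _ cl.
  exists B => _; split=> //; first by move=> x /BS[].
  exists f => //; exists e => //; suff -> : B `&` [set x | e <= `|f x - f a|] = B by [].
  by apply/seteqP; split=> [x []//|x Bx]; split=> //; have [] := BS x Bx.
pose Q_ := fix Q_ n := if n is n'.+1 then \bigcup_(a in Q_ n') B a else [set a0].
have QD n : Q_ n `<=` D.
  by elim: n => [_ -> //|n IH x [a /IH /BP[BD _ _] /BD]].
exists (\bigcup_n Q_ n); first by move=> x [n _ /QD].
split.
  apply: bigcup_countable => // n _; elim: n => [|n IH]; first exact: countable1.
  by apply: bigcup_countable => // a /QD/BP[].
split; first by exists a0, 0%N.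
move=> a [n _ Qa]; have [_ _ [f Ff [e e0 cl]]] := BP a (QD n a Qa).
exists f => //; exists e => // U /cl[x [[Bx ex] Ux]]; exists x; split=> //; split=> //.
by exists n.+1 => //; exists a.
Qed.

Lemma bad_isolated F A : bad F A -> isolated A = set0.
Proof.
move=> [_ Abad]; rewrite -subset0 => a [/set_mem Aa [V aV VA]].
have [f _ [e e0 cl]] := Abad a Aa.
have [x [[Ax /= ex] Vx]] := cl V aV.
have : (V `&` A) x by [].
by rewrite VA => /= xa; move: ex; rewrite xa subrr normr0 leNgt e0.
Qed.

Lemma open_isolated A V : open V -> isolated (A `&` V) `<=` isolated A.
Proof.
move=> oV a [/set_mem[Aa Va] [U aU UA]]; split; first exact/mem_set.
exists (U `&` V); first by apply: filterI => //; exact: open_nbhs_nbhs.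
by rewrite -UA; apply/seteqP; split=> x; [move=> [[]]|move=> [? []]].
Qed.

(** An open set separating two points cuts off a smaller non-empty part, whose isolated points are
    isolated in [A]. *)
Lemma finite_T0_isolated A : finite_set A -> A !=set0 -> T0_subspace A ->
  isolated A !=set0.
Proof.
move=> /finite_seqP[s As].
have {As} : A `<=` [set` s] by rewrite As.
have [n] := ubnP (size s); elim: n => // n IH in s A *.
rewrite ltnS => sn As [a Aa] sepA.
have [[b Ab ab]|nb] := pselect (exists2 b, A b & a <> b); last first.
  exists a; split; first exact/mem_set.
  exists setT; first exact: filterT.
  rewrite setTI; apply/seteqP; split=> [x Ax /=|_ ->//].
  by apply: contrapT => xa; apply: nb; exists x => // ax; exact: xa.
have [V oV [c [d [Ac Ad Vc nVd]]]] :
    exists2 V, open V & exists c d, [/\ A c, A d, V c & ~ V d].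
  apply: contrapT => nV; apply: ab; apply: sepA => // V oV.
  split=> Vx; apply: contrapT => nVx; apply: nV; exists V => //.
    by exists a, b.
  by exists b, a.
have ds : d \in s by exact: As.
have [x] : isolated (A `&` V) !=set0.
  apply: (IH (rem d s)).
  - by move: sn; rewrite size_rem//; case: (s) ds.
  - move=> x [Ax Vx]; have : x \in d :: rem d s.
      by rewrite -(perm_mem (perm_to_rem ds)); exact: As.
    by rewrite in_cons => /predU1P[xd|//]; rewrite xd in Vx.
  - by exists c.
  - by move=> x y [Ax _] [Ay _]; exact: sepA.
by move=> /(open_isolated _ _ oV) ?; exists x.
Qed.

Lemma everywhere_jump_not_sc A h : A !=set0 -> (forall a, A a -> jump A h a) ->
  ~ scatteredly_continuous h.
Proof. by move=> A0 hj /(_ A A0)[a /hj + /not_jump]. Qed.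

Lemma jump_series A (q : nat -> X) (g : nat -> X -> R) (C : R) :
  (forall n, A (q n) -> jump A (g n) (q n)) ->
  (forall n x, A x -> `|g n x| <= C) ->
  exists s : nat -> R, [/\ forall n, 0 <= s n, forall n, series s n <= 1 &
    forall h, (forall x, A x -> series (fun n => s n * g n x) @ \oo --> h x) ->
      forall n, A (q n) -> jump A h (q n)].
Proof.
move=> gj gC.
(* Jump sizes are chosen in advance as a function of the partial sum and the point, for use in the
   recursion. *)
have /choice[e eP] : forall p : (X -> R) * X, exists e : R, 0 < e /\ (jump A p.1 p.2 ->
    closure (A `&` [set x | e <= `|p.1 x - p.1 p.2|]) p.2).
  move=> p; have [[e e0 cl]|nj] := pselect (jump A p.1 p.2); first by exists e.
  by exists 1.
pose C' := `|C| + 1; have C'0 : 0 < C' by rewrite ltr_wpDl.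
pose coef (P : X -> R) d n : R := if pselect (jump A P (q n)) then 0 else d.
(* The sum built so far is made discontinuous at [q n], if necessary, by adding a
   multiple of [g n]; the budget [d] for all later terms is then cut down so that
   they cannot repair this discontinuity. *)
pose next (P : X -> R) d n x := P x + coef P d n * g n x.
pose st := fix st n : (X -> R) * R := if n is m.+1 then
  let: (P, d) := st m in let P' := next P d m in
  (P', Num.min (d / 2) (e (P', q m) / (8 * C'))) else (fun=> 0, 1 / 2).
pose P n := (st n).1; pose d n := (st n).2; pose s n := coef (P n) (d n) n.
have S1 n : P n.+1 = next (P n) (d n) n by rewrite /P /d /=; case: (st n).
have d1 n : d n.+1 = Num.min (d n / 2) (e (P n.+1, q n) / (8 * C')).
  by rewrite /P /d /=; case: (st n).
have d0 n : 0 < d n.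
  elim: n => [|n IH]; first by rewrite divr_gt0.
  rewrite d1 lt_min divr_gt0//= divr_gt0 ?mulr_gt0//; exact: (eP _).1.
have s0 n : 0 <= s n by rewrite /s /coef; case: pselect => j //=; exact: ltW.
have sd n : s n <= d n by rewrite /s /coef; case: pselect => j //=; exact: ltW.
have d00 : d 0%N = 1 / 2 by [].
have P0 : P 0%N = fun=> 0 by [].
have sE n : s n = coef (P n) (d n) n by [].
clearbody s; clearbody P d; clear st.
have d2 n : d n.+1 *+ 2 <= d n.
  have : d n.+1 <= d n / 2 by rewrite d1 ge_min lexx.
  by lra.
(* The coefficients from [n] on sum to at most twice the budget [d n]; since [d 0 = 1 / 2], all of
   them sum to at most 1. *)
have stail n m : series s (n + m)%N + d (n + m)%N *+ 2 <= series s n + d n *+ 2.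
  elim: m => [|m IH]; first by rewrite addn0.
  rewrite addnS seriesSr; apply: le_trans IH.
  by have := d2 (n + m)%N; have := sd (n + m)%N; lra.
have SE n x : P n x = series (fun m => s m * g m x) n.
  elim: n => [|n IH]; first by rewrite P0 /series/= big_geq.
  by rewrite seriesSr -IH S1 sE.
exists s; split=> // [n|h hE n Aqn].
  have := stail 0%N n; rewrite add0n [series s 0]/series/= big_geq//.
  have := d0 n; rewrite d00; lra.
have jS : jump A (P n.+1) (q n).
  rewrite S1 /next /coef; case: pselect => [jSn|njSn].
    rewrite (_ : (fun x => P n x + 0 * g n x) = P n) //.
    by apply/funext => x; rewrite mul0r addr0.
  by apply: jump_addZ => //; exact: gj.
have [e0 /(_ jS) cl] := eP (P n.+1, q n).
set en := e _ in e0 cl.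
(* The later terms amount to at most [2 * d n.+1 * C' <= en / 4] at each point, so a jump of size
   [en / 2] remains. *)
have near_h x : A x -> `|h x - P n.+1 x| <= en / 4.
  move=> Ax.
  have cvN : `|series (fun m => s m * g m x) k - P n.+1 x| @[k --> \oo]
      --> `|h x - P n.+1 x|.
    by apply: cvg_norm; apply: cvgB; [exact: hE|exact: cvg_cst].
  apply: cvgr_to_le cvN _; exists n.+1 => // k /= nk.
  rewrite SE; have -> : k = (n.+1 + (k - n.+1))%N by lia.
  move: (k - n.+1)%N => m.
  apply: (@le_trans _ _ ((series s (n.+1 + m)%N - series s n.+1) * C')).
    elim: m => [|m IH]; first by rewrite addn0 !subrr normr0 mul0r.
    rewrite addnS 2!(seriesSr _ (n.+1 + m)) addrAC [in leRHS]addrAC [leRHS]mulrDl.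
    apply: le_trans (ler_normD _ _) _; apply: lerD => //.
    rewrite normrM ger0_norm// ler_wpM2l//; apply: le_trans (gC _ _ Ax) _.
    by rewrite /C'; have := ler_norm C; lra.
  have dn : d n.+1 <= en / (8 * C') by rewrite d1 ge_min lexx orbT.
  apply: (@le_trans _ _ (d n.+1 *+ 2 * C')).
    rewrite ler_wpM2r ?ltW//; have := stail n.+1 m; have := d0 (n.+1 + m)%N.
    by lra.
  apply: le_trans (_ : (en / (8 * C')) *+ 2 * C' <= _).
    by rewrite ler_pM2r// lerMn2r dn.
  by rewrite le_eqVlt; apply/orP; left; apply/eqP; field; rewrite gt_eqF.
exists (en / 2); first by rewrite divr_gt0.
move=> U /cl[x [[Ax /= ex] Ux]]; exists x; split=> //; split=> //=.
have := near_h _ Ax; have := near_h _ Aqn.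
have := ler_distD (h x) (P n.+1 x) (P n.+1 (q n)).
have := ler_distD (h (q n)) (h x) (P n.+1 (q n)).
rewrite [`|P n.+1 x - h x|]distrC; lra.
Qed.

End Jumps.

(** * Weak discontinuity *)

Section WeakDiscontinuity.
Context {R : realType} {X : topologicalType}.

(** Near a point [b] of continuity of [f] on [B] one has [|f| < |f b| + 1], which leaves finitely
    many [z n]. *)
Lemma diverging_range_scattered (z : nat -> X) (f : X -> R) :
  T0_subspace (range z) -> scatteredly_continuous f ->
  (forall n, n%:R <= `|f (z n)|) -> scattered (range z).
Proof.
move=> sepz fSC zf B Bz B0.
have [b Bb fb] := fSC B B0.
move/cvgrPdist_lt : fb => /(_ 1 ltr01); rewrite near_withinE nbhsE => -[U [oU Ub] UP].
have [N fbN] : exists N : nat, `|f b| + 1 < N%:R.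
  by exists (Num.bound (`|f b| + 1)); apply: archi_boundP; rewrite addr_ge0.
have [||x y [Bx _] [By _]|x] := finite_T0_isolated (B `&` U).
- apply: (@sub_finite_set _ _ (z @` `I_N)); last exact/finite_image/finite_II.
  move=> x [Bx Ux]; have [n _ zn] := Bz x Bx; exists n => //=.
  have fx : `|f b - f x| < 1 := UP x Ux Bx.
  rewrite -(ltr_nat R); apply: le_lt_trans (zf n) _; rewrite zn.
  by have := ler_distD (f b) (f x) 0; rewrite !subr0 [`|f x - _|]distrC; lra.
- by exists b.
- exact: sepz (Bz x Bx) (Bz y By).
by move=> /(open_isolated _ _ oU) ?; exists x.
Qed.

Lemma countable_range (Q : set X) : countable Q -> Q !=set0 ->
  exists q : nat -> X, range q = Q.
Proof.
move=> /pfcard_geP[-> [x []]//|[q] _]; exists q.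
apply/seteqP; split=> [_ [n _ <-]|x Qx]; first exact: funS.
by have [n _ <-] := @surj _ _ _ _ q x Qx; exists n.
Qed.

Lemma infty_convex_weakly_discontinuous (F : set (SCp X R)) :
  countable_tightness X -> scatteredly_R_separable X ->
  potentially_bounded F -> infty_convex F ->
  weakly_discontinuous [set sc_val f | f in F].
Proof.
move=> tight sepX Fpot Fconv; apply: contrapT => /not_weakly_discontinuous.
have SC (f : SCp X R) : scatteredly_continuous f by have := sc_valP f; rewrite inE.
move=> [A A0 Ajump].
have [f0 Ff0] : exists f0, F f0.
  have [|a _ [_ [f Ff _] _]] := Ajump _ openT; first by rewrite setIT.
  by exists f.
(* Where [f0] is continuous, subtracting it from [f n] does not affect jumps. *)
have [V [oV AV0 f0V]] := scatteredly_continuous_open (SC f0) A0.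
have [|D DAV Dbad] := dense_jumps_bad [set sc_val f | f in F] (A `&` V) AV0.
  move=> W oW; rewrite -setIA => AVW0.
  have [a [Aa [Va Wa]] [f Ff fa]] := Ajump _ (openI oV oW) AVW0.
  exists a => //; exists f => //; apply: jump_nbhs => //; exact: open_nbhs_nbhs.
have [|E ED [Ebad Esep]] := bad_T0_subspace _ _ _ Dbad; first by move=> _ [f _ <-].
have [Q QE [cQ Qbad]] := bad_countable _ _ tight Ebad.
have Qsep : T0_subspace Q by move=> x y /QE Ex /QE Ey; exact: Esep.
have f0Q a : Q a -> ~ jump Q f0 a.
  move=> Qa [e e0 cl]; have /not_jump := f0V a (DAV _ (ED _ (QE _ Qa))); apply.
  exists e => // U /cl[x [[Qx ex] Ux]]; exists x; split=> //; split=> //.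
  exact: (DAV _ (ED _ (QE _ Qx))).1.
have [q qQ] := countable_range Q cQ Qbad.1.
have /choice[f fP] : forall n, exists f, F f /\ jump Q (sc_val f) (q n).
  move=> n; have [|_ [f Ff <-] fj] := Qbad.2 (q n); first by rewrite -qQ; exists n.
  by exists f.
have [t [k [t0 Fk kE kbnd]]] := 
  potentially_bounded_perturbation F f0 f Fpot Fconv Ff0 (fun n => (fP n).1).
pose g n x := k n x - f0 x.
have gj n : jump Q (g n) (q n).
  have -> : g n = fun x => - (t n * f0 x) + t n * f n x.
    by apply/funext => x; rewrite /g kE; ring.
  apply: jump_addZ (fP n).2 => //; apply/not_jump; apply: cvgN; apply: cvgMr.
  by apply/not_jump/f0Q; rewrite -qQ; exists n.
(* The reindexing [m] is the identity in the bounded case; in the other, [g (m n)] is large at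
   [z n]. *)
have sum_g (m : nat -> nat) (s : nat -> R) :
    (forall n, 0 <= s n) -> (forall n, series s n <= 1) -> exists2 h, F h &
    forall x, series (fun n => s n * g (m n) x) @ \oo --> h x - f0 x.
  move=> s0 s1; apply: (infty_convex_subsum F f0 (fun n => k (m n))) => // x.
  have [C kC] := kbnd x; exists (C + `|f0 x|) => n.
  rewrite -(subrK (f0 x) (k (m n) x)).
  by apply: le_trans (ler_normD _ _) _; rewrite lerD2r.
have [[W [oW QW0 [C gC]]]|unbnd] := pselect (exists W, [/\ open W, (Q `&` W) !=set0 &
    exists C, forall n x, (Q `&` W) x -> `|g n x| <= C]).
  have jW h a : jump Q h a -> (Q `&` W) a -> jump (Q `&` W) h a.
    by move=> j [_ Wa]; apply: jump_nbhs => //; exact: open_nbhs_nbhs.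
  have [|s [s0 s1 sj]] := jump_series (Q `&` W) q g C _ gC.
    by move=> n; exact: jW.
  have [h Fh hE] := sum_g id s s0 s1.
  apply: (everywhere_jump_not_sc _ h QW0 _ (SC h)) => a [Qa Wa].
  have [n _ qna] : range q a by rewrite qQ.
  have QWqn : (Q `&` W) (q n) by rewrite qna.
  (* The jump of [h - f0] is one of [h], because [f0] is continuous on [Q]. *)
  have := sj (fun x => h x - f0 x) (fun x _ => hE x) n QWqn; rewrite qna.
  apply: contraPP => /not_jump ha; apply/not_jump; apply: cvgB => //.
  apply/not_jump => -[e e0 cl]; apply: (f0Q a Qa); exists e => // U /cl.
  by move=> [x [[[Qx _] ex] Ux]]; exists x.
have [|z [zD nscat]] := sepX Q Qbad.1 cQ (bad_isolated _ _ Qbad)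
    (fun n => Q `&` [set x | exists m, 8 * n%:R * 4 ^+ n <= `|g m x|]).
  (* Density: on the trace of an open set missing the n-th set, all [g m] would be bounded by the
     same constant, contrary to [unbnd]. *)
  move=> n; split; first by move=> x [].
  move=> x Qx U; rewrite nbhsE => -[G [oG Gx] GU]; apply: contrapT => nG.
  apply: unbnd; exists G; split=> //; first by exists x.
  exists (8 * n%:R * 4 ^+ n) => m y [Qy Gy]; rewrite leNgt; apply/negP => /ltW gy.
  by apply: nG; exists y; split; [split=> //; exists m|exact: GU].
have /choice[m mP] : forall n, exists m, 8 * n%:R * 4 ^+ n <= `|g m (z n)|.
  by move=> n; have [_] := zD n.
(* With the offsets [f0 (z n)], the numbers kept away from zero are the values [h (z n)] of the
   function constructed next. *)
have [|u [u01 uP]] := avoidance (fun n => f0 (z n)) (fun j n => g (m j) (z n)) mP.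
  by move=> n; have [C kC] := kbnd (z n); exists C => j; exact: kC.
have [n|n|h Fh hE] := sum_g m (fun n => 2^-1 ^+ n.+1 * u n).
- by rewrite mulr_ge0//; have /andP[] := u01 n.
(* Cut at 0, the tail estimate bounds the sum of the coefficients by 1. *)
- have := @dyadic_series_tail R u 1 0 n _ (leq0n n).
  rewrite [X in _ - X]/series/= big_geq// subr0 expr0 mulr1.
  move=> /(_ _)/(le_trans (ler_norm _)); apply => j.
  by have /andP[uj0 uj1] := u01 j; rewrite ger0_norm.
apply: nscat; apply: (diverging_range_scattered z h) => // [x y|n].
  by move=> [i _ <-] [j _ <-]; apply: Qsep; have [] := zD i; have [] := zD j.
have := uP n (h (z n) - f0 (z n)); rewrite [f0 _ + _]addrC subrK; apply.
rewrite (_ : (fun j => _) = fun j => 2^-1 ^+ j.+1 * u j * g (m j) (z n)).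
  exact: hE.
by apply/funext => j; rewrite mulrA.
Qed.

End WeakDiscontinuity.

Theorem theorem9p1 (R : realType) (X : topologicalType) (F : set (SCp X R)) :
  countable_tightness X -> scatteredly_R_separable X ->
  potentially_bounded F -> infty_convex F ->
  weakly_discontinuous [set sc_val f | f in F] /\ nw (set_type F) #<= nw X.
Proof.
move=> tight sepX Fpot Fconv.
have Fwd := infty_convex_weakly_discontinuous F tight sepX Fpot Fconv.
by split=> //; exact: weakly_discontinuous_nw.
Qed.
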